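(* Let $R$ be a Baer $*$-ring. For any pair $(x,y)$ of arbitrary elements in $R$ there is a unique unity decomposition $p_{11}+p_{10}+p_{01}+p_{00}=1$ with projections $p_{11},p_{10},p_{01},p_{00}\in\{x,y\}'$ such that: (i) $(p_{11}x,p_{11}y)$ commute and are compatible; (ii) $(p_{10}x,p_{10}y)$ commute and are completely non compatible; (iii) $(p_{01}x,p_{01}y)$ completely do not commute and are compatible; (iv) $(p_{00}x,p_{00}y)$ completely do not commute and are completely non compatible.
   Context: A Baer $*$-ring is a ring $R$ with unity $1$ and an involution $*$ such that the right annihilator of every subset of $R$ is a principal right ideal generated by a projection (self-adjoint idempotent). Projections are ordered by $p\le q$ iff $pq=p$. For $x\in R$, $[x]$ denotes the left projection of $x$: the smallest projection $e$ with $ex=x$. For $T\subset R$, $T'$ is the commutant of $T$. A unity decomposition is a set of pairwise orthogonal projections with sum $1$. A pair $(x,y)$ is compatible if $[x^m][y^n]=[y^n][x^m]$ for all $m,n\ge 1$. For a projection $e$ commuting with $x,y$, the compressions $ex,ey$ are regarded as elements of the corner $eRe$ (with unity $e$). The pair $(ex,ey)$ completely does not commute (respectively is completely non compatible) if for every nonzero projection $r\le e$ commuting with $ex$ and $ey$, the pair $(rx,ry)$ does not commute (respectively is not compatible). *)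

(* Defs.v *)
From HB Require Import structures.
From mathcomp Require Import all_boot all_algebra.
From mathcomp Require Import boolp classical_sets.

Set Implicit Arguments.
Unset Strict Implicit.
Unset Printing Implicit Defensive.

Import GRing.Theory.

Local Open Scope classical_set_scope.
Local Open Scope ring_scope.

HB.mixin Record PzRing_hasStar R of GRing.PzRing R := {
  star : R -> R;
  starK : involutive star;
  starD : {morph star : x y / x + y};
  starM : forall x y, star (x * y) = star y * star x
}.

#[short(type="pzStarRingType")]
HB.structure Definition PzStarRing := {R of GRing.PzRing R & PzRing_hasStar R}.

Section StarRing.
Context {R : pzStarRingType}.
Implicit Types (S : set R) (e f p q r x y : R).

Definition projection p : Prop := p * p = p /\ star p = p.

Definition proj_le p q : Prop := p * q = p.

Definition right_annihilator S : set R := [set a | forall s, S s -> s * a = 0].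

Definition right_ideal_gen e : set R := [set e * a | a in [set: R]].

Definition commutant S : set R := [set a | forall s, S s -> GRing.comm a s].

Definition unity_decomposition (s : seq R) : Prop :=
  [/\ forall p, p \in s -> projection p,
      pairwise (fun p q => p * q == 0) s
    & \sum_(p <- s) p = 1].

(* The corner eRe is kept as a subset of R. It is a ring with unity e, and for
   a projection e its projections are the projections of R lying in it; its
   powers with positive exponent are those of R. The notions below that depend
   on the ambient ring take e as first argument: they are the notions in eRe,
   and e = 1 gives those of R. *)
Definition corner e : set R := [set e * a * e | a in [set: R]].

Definition is_lproj e x f : Prop :=
  [/\ corner e f, projection f, f * x = x
    & forall g, corner e g -> projection g -> g * x = x -> proj_le f g].

(* The default value 0 is never used in a Baer *-ring for x in eRe; see
   [lprojP]. *)
Definition lproj e x : R := xget 0 (is_lproj e x).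

Definition compatible e x y : Prop :=
  forall m n : nat, (0 < m)%N -> (0 < n)%N ->
    GRing.comm (lproj e (x ^+ m)) (lproj e (y ^+ n)).

Definition completely_noncommuting e x y : Prop :=
  forall r, projection r -> r <> 0 -> proj_le r e ->
    GRing.comm r x -> GRing.comm r y -> ~ GRing.comm (r * x) (r * y).

Definition completely_noncompatible e x y : Prop :=
  forall r, projection r -> r <> 0 -> proj_le r e ->
    GRing.comm r x -> GRing.comm r y -> ~ compatible r (r * x) (r * y).

End StarRing.

HB.mixin Record PzStarRing_isBaer R of PzStarRing R := {
  baer : forall S : set R, exists2 e : R,
    projection e & right_annihilator S = right_ideal_gen e
}.

#[short(type="baerStarRingType")]
HB.structure Definition BaerStarRing :=
  {R of PzStarRing R & PzStarRing_isBaer R}.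

Section LeftProjection.
Context {R : baerStarRingType}.
Implicit Types (e x y : R).

Lemma star0 : star (0 : R) = 0.
Proof. by apply: (addIr (star 0)); rewrite -starD !add0r. Qed.

Lemma starN x : star (- x) = - star x.
Proof. by apply/eqP; rewrite -addr_eq0 -starD addNr star0. Qed.

Lemma star1 : star (1 : R) = 1.
Proof. by rewrite -[LHS]mulr1 -[X in _ * X]starK -starM mulr1 starK. Qed.

Lemma starB x y : star (x - y) = star x - star y.
Proof. by rewrite starD starN. Qed.

Lemma lprojP e x : projection e -> corner e x -> is_lproj e x (lproj e x).
Proof.
move=> [ee se] [a _ xE].
have ex : e * x = x by rewrite -xE !mulrA ee.
have [g [gg sg] annE] := baer [set star x].
have pf : projection (1 - g).
  by split; rewrite ?starB ?star1 ?sg // mulrBr mulr1 mulrBl mul1r gg subrr subr0.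
have fx : (1 - g) * x = x.
  have xg : star x * g = 0.
    have: right_annihilator [set star x] g by rewrite annE; exists 1; rewrite ?mulr1.
    by apply.
  have := congr1 star xg; rewrite starM starK sg star0 => gx.
  by rewrite mulrBl mul1r gx subr0.
have fmin h : projection h -> h * x = x -> proj_le (1 - g) h.
  move=> [_ sh] hx.
  have: right_annihilator [set star x] (1 - h).
    move=> _ ->; rewrite mulrBr mulr1.
    by rewrite -[in X in _ - X]sh -starM hx subrr.
  rewrite annE => -[b _ hb].
  have gh : g * (1 - h) = 1 - h by rewrite -hb mulrA gg.
  have fh : (1 - g) * (1 - h) = 0 by rewrite mulrBl mul1r gh subrr.
  by move/eqP: fh; rewrite mulrBr mulr1 subr_eq0 => /eqP.
rewrite /lproj; case: xgetP => [y _ //|no].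
have fe : (1 - g) * e = 1 - g by apply: fmin.
have ef : e * (1 - g) = 1 - g by have := congr1 star fe; rewrite starM se pf.2.
have cf : corner e (1 - g) by exists (1 - g); rewrite ?ef.
by case: (no (1 - g)); split=> // h _; exact: fmin.
Qed.

End LeftProjection.

(* Main.v *)
Require Import Defs.
From mathcomp Require Import all_boot all_algebra.
From mathcomp Require Import boolp classical_sets.

Local Open Scope classical_set_scope.
Local Open Scope ring_scope.

(** Let [S = {x, y, star x, star y}]. A projection commutes with [x] and [y]
    exactly when it lies in the commutant [S'], so both properties at stake can
    be read off from annihilation by projections [p] of [S']:
    - [p x] and [p y] commute iff [p] annihilates [x y - y x];
    - [p x] and [p y] are compatible in [pRp] iff [p] annihilates every
      commutator of [[x^m]] with [[y^n]], because compression by [p] turns the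
      left projection of [z] into [p [z]] (lemma [lproj_compress]).
    In both cases the annihilated elements lie in the bicommutant [S''].

    The Baer axiom gives, for each set [K] inside [S''], a largest projection [e]
    of [S'] annihilating [K], and this [e] moreover commutes with all of [S']
    (lemma [largest_annihilating_projection]). Hence each of the two properties
    has a threshold [e] that is central in [S']: a projection [p] of [S'] has the
    property iff [p <= e], and no nonzero subprojection of [p] in [S'] has it
    iff [p e = 0] (lemma [completely_notP]).

    With thresholds [e1] for commutation and [e2] for compatibility, the four
    conditions become linear equations such as [p10 e1 = p10], [p10 e2 = 0].
    Since the [p_ij] sum to [1], these equations are equivalent to
    [p11 = e1 e2], [p10 = e1 (1 - e2)], [p01 = (1 - e1) e2] and
    [p00 = (1 - e1) (1 - e2)], which gives existence and uniqueness at once. *)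

Import GRing.Theory.

(** * Projections and commutants *)

Section StarRing.
Set Implicit Arguments.
Context {R : pzStarRingType}.
Implicit Types (S : set R) (e f g p q u x y z : R).

Definition star_closed S : Prop := forall s, S s -> S (star s).

Lemma commutant_star_closed S : star_closed S -> star_closed (commutant S).
Proof.
move=> sS u uS s /sS /uS /(congr1 star).
by rewrite !starM starK => us; rewrite /GRing.comm us.
Qed.

Definition star_pair x y : set R := [set x; y; star x; star y].

Lemma star_pair_closed x y : star_closed (star_pair x y).
Proof.
move=> s [[[->|->]|->]|->]; rewrite /star_pair /= ?starK.
- by left; right.
- by right.
- by left; left; left.
- by left; left; right.
Qed.

Lemma commutant_star_pairP x y p : projection p ->
  commutant (star_pair x y) p <-> GRing.comm p x /\ GRing.comm p y.
Proof.
move=> [_ sp]; split=> [ps|[px py]].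
  by split; apply: ps; rewrite /star_pair /=; tauto.
have comm_star z : GRing.comm p z -> GRing.comm p (star z).
  by move=> /(congr1 star); rewrite !starM sp /GRing.comm => ->.
by move=> s [[[->|->]|->]|->] //; apply: comm_star.
Qed.

Lemma bicommutant_incl S : S `<=` commutant (commutant S).
Proof. by move=> s Ss u uS; rewrite /GRing.comm uS. Qed.

Lemma commutant_mul S u z :
  commutant S u -> commutant S z -> commutant S (u * z).
Proof. by move=> uS zS s Ss; apply/commr_sym/commrM; apply/commr_sym; auto. Qed.

Lemma commutant_sub S u z :
  commutant S u -> commutant S z -> commutant S (u - z).
Proof. by move=> uS zS s Ss; apply/commr_sym/commrB; apply/commr_sym; auto. Qed.

Lemma commutant_exp S u n : commutant S u -> commutant S (u ^+ n).
Proof. by move=> uS s Ss; apply/commr_sym/commrX/commr_sym/uS. Qed.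

Lemma commutant1 S : commutant S 1.
Proof. by move=> s _; apply/commr_sym/commr1. Qed.

Lemma projection_mul p q :
  projection p -> projection q -> GRing.comm p q -> projection (p * q).
Proof.
move=> [pp sp] [qq sq] pq; split; last by rewrite starM sp sq pq.
by rewrite mulrA -(mulrA p) -pq !mulrA pp -mulrA qq.
Qed.

Lemma proj_le_anti p q :
  projection p -> projection q -> proj_le p q -> proj_le q p -> p = q.
Proof.
move=> [_ sp] [_ sq] pq qp.
by rewrite -sp -pq starM sp sq qp.
Qed.

(** A subspace invariant under both [u] and [star u] is reducing: here the
    subspace is the right ideal [gR]. *)
Lemma reducing_comm g u : projection g ->
  g * (u * g) = u * g -> g * (star u * g) = star u * g -> GRing.comm u g.
Proof.
move=> [_ sg] ug /(congr1 star).
by rewrite !starM sg starK /GRing.comm -mulrA => <-.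
Qed.

Lemma right_ideal_genP g z :
  projection g -> right_ideal_gen g z <-> g * z = z.
Proof.
move=> [gg _]; split=> [[b _ <-]|gz]; first by rewrite mulrA gg.
by exists z.
Qed.

Lemma exp_compress p x n : projection p -> GRing.comm p x -> (0 < n)%N ->
  (p * x) ^+ n = p * x ^+ n.
Proof.
move=> [pp _] px; case: n => // n _; rewrite exprMn_comm //; congr (_ * _).
by elim: n => [|n IH]; rewrite ?expr1 // exprS IH.
Qed.

Lemma mul_compress p u z : projection p -> GRing.comm p u ->
  (p * u) * (p * z) = p * (u * z).
Proof. by move=> [pp _] pu; rewrite pu mulrA -(mulrA u) pp -pu !mulrA. Qed.

Lemma comm_compress p u z : projection p -> GRing.comm p u -> GRing.comm p z ->
  GRing.comm (p * u) (p * z) <-> p * (u * z - z * u) = 0.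
Proof.
move=> pP pu pz; rewrite /GRing.comm !mul_compress // mulrBr.
by split=> [->|/eqP]; rewrite ?subrr // subr_eq0 => /eqP.
Qed.

Lemma is_lproj_unique e x f g : is_lproj e x f -> is_lproj e x g -> f = g.
Proof.
move=> [cf pf fx fmin] [cg pg gx gmin].
by apply: proj_le_anti => //; [exact: fmin | exact: gmin].
Qed.

End StarRing.

(** * Left projections and the bicommutant *)

Section Baer.
Set Implicit Arguments.
Context {R : baerStarRingType}.
Implicit Types (S K : set R) (e f g p q r u x y z : R).

Lemma projection1 : projection (1 : R).
Proof. by split; rewrite ?mulr1 ?star1. Qed.

Lemma projectionC p : projection p -> projection (1 - p).
Proof.
move=> [pp sp]; split; last by rewrite starB star1 sp.
by rewrite mulrBr mulr1 mulrBl mul1r pp subrr subr0.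
Qed.

Lemma compl_mulr p : projection p -> (1 - p) * p = 0.
Proof. by move=> [pp _]; rewrite mulrBl mul1r pp subrr. Qed.

Lemma mulr_compl p : projection p -> p * (1 - p) = 0.
Proof. by move=> [pp _]; rewrite mulrBr mulr1 pp subrr. Qed.

Lemma lproj1P x : is_lproj 1 x (lproj 1 x).
Proof.
by apply: lprojP; [exact: projection1|exists x; rewrite ?mul1r ?mulr1].
Qed.

(** Minimality of [[x]] speaks of projections only. It extends to an arbitrary
    left multiplier [z] because the right annihilator of [star x] is generated
    by a projection [g]: minimality applied to [1 - g] gives [[x] g = 0], and
    [star z] lies in [gR] as soon as [z x = 0]. *)
Lemma mul_lproj_eq0 z x : z * lproj 1 x = 0 <-> z * x = 0.
Proof.
have [_ [_ sf] fx fmin] := lproj1P x; split=> [zf|zx].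
  by rewrite -fx mulrA zf mul0r.
have [g pg annE] := baer [set star x].
have xg : (1 - g) * x = x.
  have: right_annihilator [set star x] g.
    by rewrite annE; apply/right_ideal_genP => //; case: pg.
  move/(_ _ erefl)/(congr1 star); rewrite starM starK pg.2 star0 => gx.
  by rewrite mulrBl mul1r gx subr0.
have /fmin : corner (1 : R) (1 - g) by exists (1 - g); rewrite ?mul1r ?mulr1.
move=> /(_ (projectionC pg) xg) /eqP.
rewrite /proj_le mulrBr mulr1 -subr_eq0 addrC addrA addNr add0r oppr_eq0.
move=> /eqP fg.
have: right_annihilator [set star x] (star z).
  by move=> _ ->; rewrite -starM zx star0.
rewrite annE => -[b _ zb].
by rewrite -[LHS]starK starM sf -zb mulrA fg mul0r star0.
Qed.

(** If [u] and [star u] commute with [x], the left annihilator of [x] is stable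
    under right multiplication by both, so [[x]] reduces [u]. *)
Lemma lproj_bicommutant S x : star_closed S ->
  commutant (commutant S) x -> commutant (commutant S) (lproj 1 x).
Proof.
move=> sS xSS.
have [_ pf fx _] := lproj1P x; set f := lproj 1 x in pf fx *.
have inv u : commutant S u -> (1 - f) * (u * f) = 0.
  move=> uS; rewrite mulrA; apply/mul_lproj_eq0.
  by rewrite -mulrA -(xSS _ uS) mulrA mulrBl mul1r fx subrr mul0r.
move=> u uS; apply: commr_sym; apply: reducing_comm => //; apply/esym/eqP.
  by rewrite -subr_eq0 -[X in X - _]mul1r -mulrBl inv.
rewrite -subr_eq0 -[X in X - _]mul1r -mulrBl inv //.
exact: (commutant_star_closed sS).
Qed.

Lemma lproj_compress p x : projection p -> GRing.comm p x ->
  lproj p (p * x) = p * lproj 1 x.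
Proof.
move=> pP px; have [pp sp] := pP.
have [_ pf fx fmin] := lproj1P x.
have pf_comm : GRing.comm p (lproj 1 x).
  apply: commr_sym.
  apply: (@lproj_bicommutant (star_pair x x)).
  - exact: star_pair_closed.
  - by apply: bicommutant_incl; rewrite /star_pair /=; tauto.
  - by apply/commutant_star_pairP.
have cpx : corner p (p * x) by exists x; rewrite // px -mulrA pp -px.
apply: (@is_lproj_unique _ p (p * x)); first exact: lprojP.
set f := lproj 1 x in pf fx fmin pf_comm *; split.
- by exists f; rewrite // pf_comm -mulrA pp -pf_comm.
- exact: projection_mul.
- by rewrite mul_compress // fx.
- move=> g _ [_ sg] gx.
  have: (1 - g) * p * f = 0.
    by apply/mul_lproj_eq0; rewrite -mulrA mulrBl mul1r gx subrr.
  rewrite -mulrA mulrBl mul1r => /eqP; rewrite subr_eq0 => /eqP/(congr1 star).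
  by rewrite /proj_le !starM sg sp pf.2 -pf_comm => <-.
Qed.

(** The projection comes from the Baer axiom applied to all [star (a k)], [a] in
    the bicommutant and [k] in [K]: letting [a] vary makes the annihilator
    stable under the bicommutant, so that [e] commutes with [S], and it costs
    nothing for [p] in the commutant, as [p a k = a p k]. Since [K] lies in the
    bicommutant, the annihilator is also stable under the commutant. *)
Lemma largest_annihilating_projection S K : star_closed S ->
    K `<=` commutant (commutant S) ->
  exists e, [/\ projection e, commutant S e, commutant (commutant S) e &
    forall p, projection p -> commutant S p ->
      (forall k, K k -> p * k = 0) <-> proj_le p e].
Proof.
move=> sS KSS; have sC := commutant_star_closed sS.
have sSS := commutant_star_closed sC.
pose T := [set z | exists a k,
  [/\ commutant (commutant S) a, K k & z = star (a * k)]].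
have [e eP annE] := baer T; have [ee se] := eP.
have annP z : e * z = z <-> forall a k, commutant (commutant S) a -> K k ->
    star (a * k) * z = 0.
  rewrite -right_ideal_genP // -annE; split=> [Tz a k aSS Kk|Tz _ [a [k [? ? ->]]]].
    by apply: Tz; exists a, k.
  exact: Tz.
have ann_e := (annP e).1 ee.
have eC u : commutant S u -> e * (u * e) = u * e.
  move=> uS; apply/annP => a k aSS Kk; rewrite mulrA.
  have akSS : commutant (commutant S) (star (a * k)).
    by apply/sSS/commutant_mul => //; exact: KSS.
  by rewrite (akSS _ uS) -mulrA ann_e // mulr0.
have eCC b : commutant (commutant S) b -> e * (b * e) = b * e.
  move=> bSS; apply/annP => a k aSS Kk.
  rewrite mulrA -[b]starK -starM mulrA.
  by apply: ann_e => //; apply: commutant_mul => //; exact: sSS.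
exists e; split=> //.
- move=> s Ss; apply/commr_sym/reducing_comm => //; apply: eCC.
    exact: bicommutant_incl.
  exact/bicommutant_incl/sS.
- by move=> u uS; apply/commr_sym/reducing_comm => //; apply: eC => //; exact: sC.
- move=> p [pp sp] pS; split=> [pK|pe k Kk].
    have/(congr1 star) : e * p = p; last by rewrite starM se sp.
    apply/annP => a k aSS Kk.
    by rewrite -[in LHS]sp -starM mulrA -(aSS _ pS) -mulrA pK // mulr0 star0.
  have := ann_e _ _ (@commutant1 _ _) Kk; rewrite mul1r => /(congr1 star).
  by rewrite starM starK se star0 -pe -mulrA => ->; rewrite mulr0.
Qed.

(** * Thresholds of properties of compressions *)

(** [P p] stands for a property of the pair of compressions [(p x, p y)]. *)
Definition threshold x y (P : R -> Prop) e : Prop :=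
  [/\ projection e, commutant (star_pair x y) e,
      commutant (commutant (star_pair x y)) e &
    forall p, projection p -> commutant (star_pair x y) p ->
      P p <-> proj_le p e].

Definition completely_not x y (P : R -> Prop) p : Prop :=
  forall r, projection r -> r <> 0 -> proj_le r p ->
    GRing.comm r x -> GRing.comm r y -> ~ P r.

Lemma completely_notP x y P e p : threshold x y P e ->
  projection p -> commutant (star_pair x y) p ->
  completely_not x y P p <-> p * e = 0.
Proof.
move=> [eP eS eSS Pe] pP pS; have pe := eSS _ pS.
have [ee _] := eP; split=> [noP|pe0 r rP r0 rp rx ry].
  apply: contrapT => pe0.
  have peP : projection (p * e) by exact: projection_mul.
  have peS := commutant_mul pS eS.
  have [pex pey] := (commutant_star_pairP x y peP).1 peS.
  apply: (noP _ peP pe0 _ pex pey).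
    by rewrite /proj_le -mulrA pe mulrA pP.1.
  by apply/Pe => //; rewrite /proj_le -mulrA ee.
have rS : commutant (star_pair x y) r by apply/commutant_star_pairP.
by move/(Pe _ rP rS) => re; apply: r0; rewrite -re -rp -mulrA pe0 mulr0.
Qed.

Lemma comm_threshold x y :
  exists e, threshold x y (fun p => GRing.comm (p * x) (p * y)) e.
Proof.
have [e|e [eP eS eSS eK]] := @largest_annihilating_projection (star_pair x y)
  [set x * y - y * x] (@star_pair_closed _ x y).
  move->; apply: commutant_sub; apply: commutant_mul;
    by apply: bicommutant_incl; rewrite /star_pair /=; tauto.
exists e; split=> // p pP pS; rewrite -eK //.
have [px py] := (commutant_star_pairP x y pP).1 pS.
rewrite comm_compress //; split=> [pc _ -> //|]; exact.
Qed.

Lemma compatible_threshold x y :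
  exists e, threshold x y (fun p => compatible p (p * x) (p * y)) e.
Proof.
pose c m n := lproj 1 (x ^+ m) * lproj 1 (y ^+ n)
  - lproj 1 (y ^+ n) * lproj 1 (x ^+ m).
have sS := @star_pair_closed R x y.
have lxSS m : commutant (commutant (star_pair x y)) (lproj 1 (x ^+ m)).
  apply/lproj_bicommutant/commutant_exp/bicommutant_incl => //.
  by rewrite /star_pair /=; tauto.
have lySS n : commutant (commutant (star_pair x y)) (lproj 1 (y ^+ n)).
  apply/lproj_bicommutant/commutant_exp/bicommutant_incl => //.
  by rewrite /star_pair /=; tauto.
have [_ [m [n [_ _ ->]]]|e [eP eS eSS eK]] := @largest_annihilating_projection
  (star_pair x y) [set z | exists m n, [/\ (0 < m)%N, (0 < n)%N & z = c m n]] sS.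
  by apply: commutant_sub; apply: commutant_mul.
exists e; split=> // p pP pS; rewrite -eK //.
have [px py] := (commutant_star_pairP x y pP).1 pS.
have compE m n : (0 < m)%N -> (0 < n)%N ->
    GRing.comm (lproj p ((p * x) ^+ m)) (lproj p ((p * y) ^+ n))
    <-> p * c m n = 0.
  move=> m0 n0; rewrite !exp_compress // !lproj_compress //; try exact: commrX.
  by apply: comm_compress => //; apply: commr_sym; [exact: lxSS|exact: lySS].
split=> [comp _ [m [n [m0 n0 ->]]]|pc m n m0 n0]; first exact/compE/comp.
by apply/compE => //; apply: pc; exists m, n.
Qed.

(** Both notions with an explicit corner have the shape of the left-hand side.
    For [r <= p] the element [r] commutes with [p z] iff it commutes with [z],
    and compressing [p z] by [r] gives [r z]: the corner can be forgotten. *)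
Lemma completely_not_compress x y (Q : R -> R -> R -> Prop) p :
    projection p -> commutant (star_pair x y) p ->
  (forall r, projection r -> r <> 0 -> proj_le r p ->
     GRing.comm r (p * x) -> GRing.comm r (p * y) ->
     ~ Q r (r * (p * x)) (r * (p * y))) <->
  completely_not x y (fun r => Q r (r * x) (r * y)) p.
Proof.
move=> pP pS; have [_ sp] := pP.
have [px py] := (commutant_star_pairP x y pP).1 pS.
have commE r z : projection r -> proj_le r p -> GRing.comm p z ->
    GRing.comm r (p * z) <-> GRing.comm r z.
  move=> [_ sr] rp pz; have pr : p * r = r.
    by have := congr1 star rp; rewrite starM sr sp.
  by rewrite /GRing.comm mulrA rp pz -mulrA pr.
by split=> noQ r rP r0 rp rx ry; have := noQ r rP r0 rp;
  rewrite !mulrA rp; apply; apply/commE.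
Qed.

(** * The four corners of two commuting projections *)

Lemma four_corners_unity e f : projection e -> projection f -> GRing.comm e f ->
  unity_decomposition [:: e * f; e * (1 - f); (1 - e) * f; (1 - e) * (1 - f)].
Proof.
move=> eP fP ef.
have eCP := projectionC eP; have fCP := projectionC fP.
have comm1 (a b : R) : GRing.comm a b -> GRing.comm a (1 - b).
  by move=> ab; apply: commrB => //; exact: commr1.
have efC := comm1 _ _ ef; have fe := commr_sym ef.
have eCf := commr_sym (comm1 _ _ fe).
have eCfC := comm1 _ _ eCf.
have zero (a b a' b' : R) : GRing.comm b a' -> a * a' = 0 \/ b * b' = 0 ->
    a * b * (a' * b') == 0.
  move=> ba' ab; rewrite mulrA -(mulrA a) ba' mulrA -mulrA.
  by case: ab => ->; rewrite ?mul0r ?mulr0.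
have fCe := commr_sym efC; have feC := commr_sym eCf.
have fCeC := commr_sym eCfC.
have [oe oe'] := (mulr_compl eP, compl_mulr eP).
have [of_ of_'] := (mulr_compl fP, compl_mulr fP).
split.
- move=> p; rewrite !inE => /or4P[] /eqP ->; exact: projection_mul.
- by rewrite /= !andbT !zero //; auto.
- rewrite !big_cons big_nil addr0 addrA -!mulrDr.
  by rewrite [f + _]addrC subrK !mulr1 addrC subrK.
Qed.

(** Multiplying the sum by [e] gives [e = p11 + p10], and by [f] after that
    separates the two terms; likewise for [1 - e = p01 + p00]. *)
Lemma four_corners_unique e f p11 p10 p01 p00 :
    p11 + (p10 + (p01 + p00)) = 1 ->
    p11 * e = p11 /\ p11 * f = p11 ->
    p10 * e = p10 /\ p10 * f = 0 ->
    p01 * e = 0 /\ p01 * f = p01 ->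
    p00 * e = 0 /\ p00 * f = 0 ->
  [/\ e * f = p11, e * (1 - f) = p10, (1 - e) * f = p01
    & (1 - e) * (1 - f) = p00].
Proof.
move=> p1 [e11 f11] [e10 f10] [e01 f01] [e00 f00].
have eE : e = p11 + p10.
  by rewrite -[LHS]mul1r -p1 !mulrDl e11 e10 e01 e00 !addr0.
have eCE : 1 - e = p01 + p00.
  by rewrite -p1 addrA eE [_ + (_ + _)]addrC addrK.
split.
- by rewrite eE mulrDl f11 f10 addr0.
- by rewrite mulrBr mulr1 eE mulrDl f11 f10 addr0 addrC addKr.
- by rewrite eCE mulrDl f01 f00 addr0.
- by rewrite mulrBr mulr1 eCE mulrDl f01 f00 addr0 addrC addKr.
Qed.

End Baer.

Theorem theorem3p9 (R : baerStarRingType) (x y : R) :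
  exists! p : R * R * R * R, let: (p11, p10, p01, p00) := p in
    unity_decomposition [:: p11; p10; p01; p00] /\
    [set p11; p10; p01; p00] `<=` commutant [set x; y] /\
    (GRing.comm (p11 * x) (p11 * y) /\
     compatible p11 (p11 * x) (p11 * y)) /\
    (GRing.comm (p10 * x) (p10 * y) /\
     completely_noncompatible p10 (p10 * x) (p10 * y)) /\
    (completely_noncommuting p01 (p01 * x) (p01 * y) /\
     compatible p01 (p01 * x) (p01 * y)) /\
    (completely_noncommuting p00 (p00 * x) (p00 * y) /\
     completely_noncompatible p00 (p00 * x) (p00 * y)).
Proof.
have [e1 te1] := comm_threshold x y; have [e1P e1S e1SS leq1] := te1.
have [e2 te2] := compatible_threshold x y; have [e2P e2S e2SS leq2] := te2.
have [[e11 _] [e22 _]] := (e1P, e2P).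
have cP p : projection p -> commutant (star_pair x y) p ->
    GRing.comm (p * x) (p * y) <-> p * e1 = p by exact: leq1.
have kP p : projection p -> commutant (star_pair x y) p ->
    compatible p (p * x) (p * y) <-> p * e2 = p by exact: leq2.
have nc p : projection p -> commutant (star_pair x y) p ->
    completely_noncommuting p (p * x) (p * y) <-> p * e1 = 0.
  move=> pP pS; rewrite -(completely_notP te1) //.
  exact: (completely_not_compress (fun _ => @GRing.comm R)).
have ncp p : projection p -> commutant (star_pair x y) p ->
    completely_noncompatible p (p * x) (p * y) <-> p * e2 = 0.
  move=> pP pS; rewrite -(completely_notP te2) //.
  exact: (completely_not_compress (@compatible R)).
have e12 : GRing.comm e1 e2 by exact: e1SS.
have SC e : commutant (star_pair x y) e -> commutant (star_pair x y) (1 - e).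
  by apply: commutant_sub; exact: commutant1.
have mul_e2 a b : a * b * e2 = a * (b * e2) by rewrite mulrA.
have mul_e1 a b : commutant (star_pair x y) b -> a * b * e1 = a * e1 * b.
  by move=> bS; rewrite -!mulrA (e1SS b).
exists (e1 * e2, e1 * (1 - e2), (1 - e1) * e2, (1 - e1) * (1 - e2)); split.
  have UD := four_corners_unity e1P e2P e12; have [projs _ _] := UD.
  have S1 := SC _ e1S; have S2 := SC _ e2S.
  have [P11 P10 P01 P00] : [/\ projection (e1 * e2), projection (e1 * (1 - e2)),
      projection ((1 - e1) * e2) & projection ((1 - e1) * (1 - e2))].
    by split; apply: projs; rewrite !inE eqxx ?orbT.
  have S11 := commutant_mul e1S e2S; have S10 := commutant_mul e1S S2.
  have S01 := commutant_mul S1 e2S; have S00 := commutant_mul S1 S2.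
  split=> //; split.
    have inC p : projection p -> commutant (star_pair x y) p ->
        commutant [set x; y] p.
      by move=> pP /(commutant_star_pairP x y pP)[px py] _ [->|->].
    by move=> _ [[[->|->]|->]|->]; exact: inC.
  rewrite (cP _ P11) // (kP _ P11) // (cP _ P10) // (ncp _ P10) //
    (nc _ P01) // (kP _ P01) // (nc _ P00) // (ncp _ P00) //.
  rewrite !(mul_e1 _ _ e2S) !(mul_e1 _ _ S2) e11 compl_mulr // !mul0r.
  by rewrite !mul_e2 compl_mulr // e22 !mulr0.
move=> [[[p11 p10] p01] p00] [[projs _ sum1] [subC [C11 [C10 [C01 C00]]]]].
have pS p : projection p -> commutant [set x; y] p ->
    commutant (star_pair x y) p.
  by move=> pP pC; apply/commutant_star_pairP => //; split; apply: pC;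
    [left | right].
have [P11 P10 P01 P00] : [/\ projection p11, projection p10,
    projection p01 & projection p00].
  by split; apply: projs; rewrite !inE eqxx ?orbT.
have [S11 S10 S01 S00] : [/\ commutant (star_pair x y) p11,
    commutant (star_pair x y) p10, commutant (star_pair x y) p01
    & commutant (star_pair x y) p00].
  by split; apply: pS => //; apply: subC => /=; tauto.
have sum1' : p11 + (p10 + (p01 + p00)) = 1.
  by rewrite -sum1 !big_cons big_nil addr0.
move: C11 C10 C01 C00.
rewrite (cP _ P11) // (kP _ P11) // (cP _ P10) // (ncp _ P10) //
  (nc _ P01) // (kP _ P01) // (nc _ P00) // (ncp _ P00) //.
move=> C11 C10 C01 C00.
by have [-> -> -> ->] :=
  @four_corners_unique _ _ _ _ _ _ _ sum1' C11 C10 C01 C00.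
Qed.
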